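(* Each of the two families of functors $TP_r^+:\mathbf{Met}\to\mathbf{Met}$ and $TP_r^-:\mathbf{Met}\to\mathbf{Met}$ ($r\in[0,\infty]$), equipped with the maps $\eta_X$ and $\mu_X$ given in the context, is an $\mathcal R$-graded monad on $\mathbf{Met}$, where $\mathcal R=[0,\infty]$ is the pre-ordered monoid of extended non-negative reals with the usual order and addition.
   Context: $\mathbf{Met}$ is the category of extended pseudo-metric spaces (sets $A$ with $d_A:A\times A\to[0,\infty]$ satisfying $d(a,a)=0$, symmetry and the triangle inequality) and non-expansive maps. $P$ is the powerset monad on sets, with $\tilde\eta_X(x)=\{x\}$ and $\tilde\mu_X:P(PX)\to PX$ the union. For a metric space $(X,d_X)$ the carrier sets are $TP_r^+(X)=\{(x,A)\in X\times PX\mid \text{for all }a\in A,\ d_X(x,a)\le r\}$, $TP_r^-(X)=\{(x,A)\in X\times PX\mid \text{there exists }a\in A\text{ with }d_X(x,a)\le r\}$, both with metric $d((x,A),(y,B))=d_X(x,y)$. On morphisms, $f:X\to Y$ acts by $(x,A)\mapsto(f(x),f(A))$ with $f(A)$ the direct image. For $q\le r$ the map $(q\le r)$ is the inclusion. For both variants, $\eta_X:X\to TP_0X$ is $\eta_X(x)=(x,\tilde\eta_X(x))$, and $\mu_X=\mu_{q,r,X}:TP_q(TP_rX)\to TP_{q+r}X$ is $\mu_X((x,A),\{(y_i,B_i)\mid i\in I\})=(x,\tilde\mu_X(\{B_i\mid i\in I\}))$. **Graded monad.** An $\mathcal R$-graded monad on a category consists of endofunctors $T_r$ ($r\in\mathcal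 R$), natural transformations $(q\le r):T_q\to T_r$ for $q\le r$ (functorial in the order), $\eta:\mathrm{Id}\to T_0$, and $\mu_{q,r}:T_qT_r\to T_{q+r}$ (compatible with the maps $(q\le r)$ in both indices), such that for all objects $A$: $\mu_{0,r,A}\circ\eta_{T_rA}=\mathrm{id}_{T_rA}=\mu_{r,0,A}\circ T_r\eta_A$ and $\mu_{p,q+r,A}\circ T_p\mu_{q,r,A}=\mu_{p+q,r,A}\circ\mu_{p,q,T_rA}$. *)

(* Defs.v *)
From mathcomp Require Import all_boot all_order all_algebra.
From mathcomp Require Import boolp classical_sets reals interval_inference.
From mathcomp Require Import constructive_ereal.

Set Implicit Arguments.
Unset Strict Implicit.
Unset Printing Implicit Defensive.

Import Order.TTheory.
Local Open Scope classical_set_scope.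
Local Open Scope ring_scope.

Record category := Category {
  obj :> Type;
  hom : obj -> obj -> Type;
  idm : forall a, hom a a;
  compm : forall a b c, hom b c -> hom a b -> hom a c;
  comp1m : forall a b (f : hom a b), compm (idm b) f = f;
  compm1 : forall a b (f : hom a b), compm f (idm a) = f;
  compmA : forall a b c d (f : hom c d) (g : hom b c) (h : hom a b),
    compm f (compm g h) = compm (compm f g) h
}.

Declare Scope cat_scope.
Delimit Scope cat_scope with cat.
Local Open Scope cat_scope.
Notation "g '\oc' f" := (compm g f) (at level 40, left associativity) : cat_scope.

Record functor_on (C D : category) (F0 : C -> D) := FunctorOn {
  fhom : forall a b, hom a b -> hom (F0 a) (F0 b);
  fhom1 : forall a, fhom (idm a) = idm (F0 a);
  fhomM : forall a b c (g : hom b c) (f : hom a b),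
    fhom (g \oc f) = fhom g \oc fhom f
}.

Record functor (C D : category) := Functor {
  fobj :> C -> D;
  functor_str : functor_on fobj
}.

Definition fmap (C D : category) (F : functor C D) a b (f : hom a b) :
  hom (F a) (F b) := fhom (functor_str F) f.

Definition functor_id (C : category) : functor C C :=
  @Functor C C id
    (@FunctorOn C C id (fun a b f => f) (fun=> erefl) (fun _ _ _ _ _ => erefl)).

Section FunctorComposition.
Variables (C D E : category) (G : functor D E) (F : functor C D).

Definition functor_comp_map (a b : C) (f : hom a b) :
    hom (G (F a)) (G (F b)) := fmap G (fmap F f).

Fact functor_comp1 a : functor_comp_map (idm a) = idm (G (F a)).
Proof. by rewrite /functor_comp_map /fmap !fhom1. Qed.

Fact functor_compM a b c (g : hom b c) (f : hom a b) :
  functor_comp_map (g \oc f) = functor_comp_map g \oc functor_comp_map f.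
Proof. by rewrite /functor_comp_map /fmap !fhomM. Qed.

Definition functor_comp : functor C E :=
  @Functor C E (fun a => G (F a)) (FunctorOn functor_comp1 functor_compM).

End FunctorComposition.

Record nattrans (C D : category) (F G : functor C D) := NatTrans {
  component :> forall a, hom (F a) (G a);
  naturality : forall a b (f : hom a b),
    component b \oc fmap F f = fmap G f \oc component a
}.

Record preordered_monoid (disp : Order.disp_t) := PreorderedMonoid {
  grade :> preorderType disp;
  gzero : grade;
  gadd : grade -> grade -> grade;
  gaddA : associative gadd;
  gadd0l : left_id gzero gadd;
  gadd0r : right_id gzero gadd;
  gadd_le : forall q q' r r' : grade,
    (q <= q')%O -> (r <= r')%O -> (gadd q r <= gadd q' r')%O
}.
Arguments gzero {disp p}.
Arguments gadd {disp p} _ _.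
Arguments gadd0l {disp p} _.
Arguments gadd0r {disp p} _.
Arguments gaddA {disp p} _ _ _.

(* The identity morphism [T r a -> T s a] for equal grades [r = s]: the monad
   laws equate morphisms whose codomains are, e.g., [T (0 + r) a] and [T r a],
   and in the type theory these are equal only propositionally. *)
Definition regrade (C : category) (I : Type) (T : I -> functor C C) (r s : I)
    (e : r = s) (a : C) : hom (T r a) (T s a) :=
  match e in _ = s return hom (T r a) (T s a) with erefl => idm (T r a) end.

Record graded_monad (C : category) (disp : Order.disp_t)
    (I : preordered_monoid disp) (T : I -> functor C C) := GradedMonad {
  gm_incl : forall q r : I, (q <= r)%O -> nattrans (T q) (T r);
  gm_unit : nattrans (functor_id C) (T gzero);
  gm_mult : forall q r : I, nattrans (functor_comp (T q) (T r)) (T (gadd q r));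
  gm_incl_refl : forall (r : I) (h : (r <= r)%O) a, gm_incl h a = idm (T r a);
  gm_incl_trans : forall (p q r : I) (h : (p <= q)%O) (k : (q <= r)%O)
    (l : (p <= r)%O) a, gm_incl k a \oc gm_incl h a = gm_incl l a;
  gm_mult_incl : forall (q q' r r' : I) (h : (q <= q')%O) (k : (r <= r')%O) a,
    gm_incl (gadd_le h k) a \oc gm_mult q r a
    = gm_mult q' r' a \oc (gm_incl h (T r' a) \oc fmap (T q) (gm_incl k a));
  gm_mult_unitl : forall (r : I) a,
    regrade T (gadd0l r) a \oc (gm_mult gzero r a \oc gm_unit (T r a))
    = idm (T r a);
  gm_mult_unitr : forall (r : I) a,
    regrade T (gadd0r r) a \oc (gm_mult r gzero a \oc fmap (T r) (gm_unit a))
    = idm (T r a);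
  gm_mult_assoc : forall (p q r : I) a,
    regrade T (gaddA p q r) a
      \oc (gm_mult p (gadd q r) a \oc fmap (T p) (gm_mult q r a))
    = gm_mult (gadd p q) r a \oc gm_mult p q (T r a)
}.

Section ExtendedNonnegativeReals.
Variable R : realType.
Local Open Scope ereal_scope.

(* [{nonneg \bar R}] contains [+oo]. *)
Definition nnadd (x y : {nonneg \bar R}) : {nonneg \bar R} :=
  (adde x%:num y%:num)%:nng.

Definition nn0 : {nonneg \bar R} := (0%R%:E)%:nng.

Fact nnaddA : associative nnadd.
Proof. by move=> x y z; apply: val_inj; exact: addeA. Qed.

Fact nnadd0l : left_id nn0 nnadd.
Proof. by move=> x; apply: val_inj; exact: add0e. Qed.

Fact nnadd0r : right_id nn0 nnadd.
Proof. by move=> x; apply: val_inj; exact: adde0. Qed.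

Fact nnadd_le (q q' r r' : {nonneg \bar R}) :
  (q <= q')%O -> (r <= r')%O -> (nnadd q r <= nnadd q' r')%O.
Proof. exact: leeD. Qed.

Definition nnereal := PreorderedMonoid nnaddA nnadd0l nnadd0r nnadd_le.

End ExtendedNonnegativeReals.

Section Met.
Variable R : realType.
Local Open Scope ereal_scope.

Record metspace := MetSpace {
  carrier :> Type;
  dist : carrier -> carrier -> \bar R;
  dist_ge0 : forall x y, 0 <= dist x y;
  dist_refl : forall x, dist x x = 0;
  dist_sym : forall x y, dist x y = dist y x;
  dist_triangle : forall x y z, dist x z <= dist x y + dist y z
}.

Record nonexp (X Y : metspace) := NonExp {
  nonexp_fun :> X -> Y;
  nonexpP : forall x x', dist (nonexp_fun x) (nonexp_fun x') <= dist x x'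
}.

Lemma nonexp_eq (X Y : metspace) (f g : nonexp X Y) : f =1 g -> f = g.
Proof.
case: f g => [f fP] [g gP] /= /funext fg.
by case: _ / fg gP => gP; rewrite (Prop_irrelevance fP gP).
Qed.

Definition nonexp_id (X : metspace) : nonexp X X :=
  @NonExp X X id (fun x x' => lexx _).

Definition nonexp_comp (X Y Z : metspace) (g : nonexp Y Z) (f : nonexp X Y) :
    nonexp X Z :=
  @NonExp X Z (g \o f) (fun x x' => le_trans (nonexpP g _ _) (nonexpP f x x')).

Fact nonexp_comp1m (X Y : metspace) (f : nonexp X Y) :
  nonexp_comp (nonexp_id Y) f = f.
Proof. exact: nonexp_eq. Qed.

Fact nonexp_compm1 (X Y : metspace) (f : nonexp X Y) :
  nonexp_comp f (nonexp_id X) = f.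
Proof. exact: nonexp_eq. Qed.

Fact nonexp_compA (X Y Z W : metspace) (f : nonexp Z W) (g : nonexp Y Z)
    (h : nonexp X Y) :
  nonexp_comp f (nonexp_comp g h) = nonexp_comp (nonexp_comp f g) h.
Proof. exact: nonexp_eq. Qed.

Definition Met : category :=
  Category nonexp_comp1m nonexp_compm1 nonexp_compA.

Definition pullback_metspace (A : Type) (X : metspace) (f : A -> X) : metspace :=
  @MetSpace A (fun u v => dist (f u) (f v)) (fun _ _ => dist_ge0 _ _)
    (fun _ => dist_refl _) (fun _ _ => dist_sym _ _)
    (fun _ _ _ => dist_triangle _ _ _).

Definition Peta (X : Type) (x : X) : set X := [set x].
Definition Pmu (X : Type) (S : set (set X)) : set X := \bigcup_(A in S) A.

Definition TPplus (r : nnereal R) (X : metspace) : metspace :=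
  pullback_metspace (fun u : {xA : X * set X |
    forall a, xA.2 a -> dist xA.1 a <= r%:num} => (sval u).1).

Definition TPminus (r : nnereal R) (X : metspace) : metspace :=
  pullback_metspace (fun u : {xA : X * set X |
    exists2 a, xA.2 a & dist xA.1 a <= r%:num} => (sval u).1).

Definition TPplus_pair (r : nnereal R) (X : metspace) (u : TPplus r X) :
  X * set X := sval u.

Definition TPminus_pair (r : nnereal R) (X : metspace) (u : TPminus r X) :
  X * set X := sval u.

Definition mapm (X Y : Met) (f : hom X Y) : X -> Y := nonexp_fun f.

(* The action on morphisms, the maps [q <= r], the unit and the multiplication
   are prescribed as functions on underlying pairs [(x, A)], read off through
   [pr] ([TPplus_pair] or [TPminus_pair]); as [pr] is injective, they determine
   [F] and the data of [M].  That these functions land in the right subspaces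
   and are non-expansive is part of the existence claim. *)
Definition TP_graded_monad (T : nnereal R -> Met -> Met)
    (pr : forall r X, carrier (T r X) -> carrier X * set (carrier X)) : Prop :=
  exists F : forall r, functor_on (T r),
    (forall r (X Y : Met) (f : hom X Y) (u : carrier (T r X)),
       pr r Y (mapm (fhom (F r) f) u) = (mapm f (pr r X u).1, mapm f @` (pr r X u).2))
    /\
  exists M : graded_monad (fun r => Functor (F r)),
    [/\ (forall (q r : nnereal R) (h : (q <= r)%O) X (u : carrier (T q X)),
           pr r X (mapm (gm_incl M h X) u) = pr q X u),
        (forall X (x : carrier X), pr gzero X (mapm (gm_unit M X) x) = (x, Peta x))
      & (forall q r X (u : carrier (T q (T r X))),
           pr (gadd q r) X (mapm (gm_mult M q r X) u)
           = ((pr r X (pr q (T r X) u).1).1,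
              Pmu [set (pr r X yB).2 | yB in (pr q (T r X) u).2]))].

End Met.

(* Main.v *)
(* Since [d((x, A), (y, B)) = d(x, y)] ignores the subsets, every prescribed map
   is non-expansive as soon as it is well defined, and every law reduces to an
   identity of the powerset monad.  Well-definedness of the multiplication is
   the triangle inequality. *)
Require Import Defs.
From mathcomp Require Import all_boot all_order.
From mathcomp Require Import boolp classical_sets reals interval_inference.
From mathcomp Require Import constructive_ereal.

Set Implicit Arguments.
Unset Strict Implicit.
Unset Printing Implicit Defensive.

Import Order.TTheory.
Local Open Scope classical_set_scope.
Local Open Scope cat_scope.

(** [bigcup_image] for the identity family, phrased with [Pmu] so that a multiplication rewrites to
    an indexed union without unfolding. *)
Lemma bigcup_in_image (A X : Type) (D : set A) (F : A -> set X) :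
  Pmu [set F i | i in D] = \bigcup_(i in D) F i.
Proof. exact: bigcup_image. Qed.

Section PointedSubsets.
Variable R : realType.

(** Common form of [TPplus r] and [TPminus r], so that one construction serves both variants. *)
Definition pointed_subsets (Q : forall X : metspace R, X * set X -> Prop)
    (X : metspace R) : metspace R :=
  pullback_metspace (fun u : {xA : X * set X | Q X xA} => (sval u).1).

(** One closure condition for each map that must be well defined. No law is assumed. In [adm_mult]
    the conditions at both levels are carried by the element [u] itself. *)
Record admissible (Q : nnereal R -> forall X : metspace R, X * set X -> Prop) :
    Prop := Admissible {
  adm_map : forall r (X Y : metspace R) (f : nonexp X Y) xA,
    Q r X xA -> Q r Y (f xA.1, f @` xA.2);
  adm_le : forall (q r : nnereal R) X xA, (q <= r)%O -> Q q X xA -> Q r X xA;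
  adm_unit : forall (X : metspace R) (x : X), Q gzero X (x, Peta x);
  adm_mult : forall q r X (u : pointed_subsets (Q q) (pointed_subsets (Q r) X)),
    Q (gadd q r) X
      ((sval (sval u).1).1, Pmu [set (sval yB).2 | yB in (sval u).2])
}.

Variable Q : nnereal R -> forall X : metspace R, X * set X -> Prop.
Hypothesis admQ : admissible Q.

Definition TP (r : nnereal R) (X : Met R) : Met R := pointed_subsets (Q r) X.

Definition TP_pair (r : nnereal R) (X : metspace R) (u : carrier (TP r X)) :
  X * set X := sval u.

(** Proof irrelevance: elements differ only through their pairs. *)
Lemma TP_pair_inj r X : injective (@TP_pair r X).
Proof.
move=> [u Qu] [v Qv]; rewrite /TP_pair /= => uv.
by case: _ / uv Qv => Qv; rewrite (Prop_irrelevance Qu Qv).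
Qed.

Lemma eq_TP_hom (Z : metspace R) r X (f g : nonexp Z (TP r X)) :
  (forall z, TP_pair (f z) = TP_pair (g z)) -> f = g.
Proof. by move=> fg; apply: nonexp_eq => z; apply: TP_pair_inj. Qed.

Definition TP_map r (X Y : Met R) (f : hom X Y) : hom (TP r X) (TP r Y) :=
  @NonExp R (TP r X) (TP r Y)
    (fun u => exist _ _ (adm_map admQ f (svalP u)))
    (fun u v => nonexpP f (sval u).1 (sval v).1).

Fact TP_map1 r X : TP_map r (idm X) = idm (TP r X).
Proof.
apply: (@eq_TP_hom (TP r X)) => -[[x A] QA].
by rewrite /TP_pair /= image_id.
Qed.

Fact TP_mapM r (X Y Z : Met R) (g : hom Y Z) (f : hom X Y) :
  TP_map r (g \oc f) = TP_map r g \oc TP_map r f.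
Proof.
apply: (@eq_TP_hom (TP r X)) => -[[x A] QA].
by rewrite /TP_pair /= image_comp.
Qed.

Definition TP_functor_on r : functor_on (TP r) :=
  FunctorOn (@TP_map1 r) (@TP_mapM r).

Definition TP_functor r : functor (Met R) (Met R) := Functor (TP_functor_on r).

Definition TP_incl_hom (q r : nnereal R) (qr : (q <= r)%O) (X : Met R) :
    hom (TP_functor q X) (TP_functor r X) :=
  @NonExp R (TP q X) (TP r X)
    (fun u => exist _ _ (adm_le admQ qr (svalP u))) (fun u v => lexx _).

Fact TP_incl_natural q r (qr : (q <= r)%O) (X Y : Met R) (f : hom X Y) :
  TP_incl_hom qr Y \oc fmap (TP_functor q) f
  = fmap (TP_functor r) f \oc TP_incl_hom qr X.
(* An inclusion only changes the membership proof, so both sides have convertible pairs. *)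
Proof. exact: (@eq_TP_hom (TP q X)). Qed.

Definition TP_incl q r (qr : (q <= r)%O) :
    nattrans (TP_functor q) (TP_functor r) :=
  NatTrans (TP_incl_natural qr).

Fact TP_incl_refl (r : nnereal R) (h : (r <= r)%O) X :
  TP_incl h X = idm (TP_functor r X).
Proof. exact: (@eq_TP_hom (TP r X)). Qed.

Fact TP_incl_trans (p q r : nnereal R) (h : (p <= q)%O) (k : (q <= r)%O)
    (l : (p <= r)%O) X :
  TP_incl k X \oc TP_incl h X = TP_incl l X.
Proof. exact: (@eq_TP_hom (TP p X)). Qed.

Definition TP_unit_hom (X : Met R) : hom X (TP_functor gzero X) :=
  @NonExp R X (TP gzero X)
    (fun x => exist _ _ (adm_unit admQ x)) (fun x y => lexx _).

Fact TP_unit_natural (X Y : Met R) (f : hom X Y) :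
  TP_unit_hom Y \oc fmap (functor_id (Met R)) f
  = fmap (TP_functor gzero) f \oc TP_unit_hom X.
Proof.
apply: (@eq_TP_hom X) => x.
by rewrite /TP_pair /= /Peta image_set1.
Qed.

Definition TP_unit : nattrans (functor_id (Met R)) (TP_functor gzero) :=
  NatTrans TP_unit_natural.

Definition TP_mult_hom (q r : nnereal R) (X : Met R) :
    hom (TP_functor q (TP_functor r X)) (TP_functor (gadd q r) X) :=
  @NonExp R (TP q (TP r X)) (TP (gadd q r) X)
    (fun u => exist _ _ (adm_mult admQ u)) (fun u v => lexx _).

Fact TP_mult_natural q r (X Y : Met R) (f : hom X Y) :
  TP_mult_hom q r Y \oc fmap (functor_comp (TP_functor q) (TP_functor r)) f
  = fmap (TP_functor (gadd q r)) f \oc TP_mult_hom q r X.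
Proof.
apply: (@eq_TP_hom (TP q (TP r X))) => -[[x A] QA].
rewrite /TP_pair /=; congr pair.
(* Direct image commutes with unions. *)
by rewrite !bigcup_in_image bigcup_image image_bigcup.
Qed.

Definition TP_mult q r :
    nattrans (functor_comp (TP_functor q) (TP_functor r))
             (TP_functor (gadd q r)) :=
  NatTrans (@TP_mult_natural q r).

(** The type of pairs does not depend on the grade, so the transport in the unit and associativity
    laws is invisible on pairs. *)
Lemma TP_pair_regrade r s (e : r = s) X (u : TP r X) :
  TP_pair (mapm (regrade TP_functor e X) u) = TP_pair u.
Proof. by case: _ / e. Qed.

Fact TP_mult_incl (q q' r r' : nnereal R) (h : (q <= q')%O) (k : (r <= r')%O) X :
  TP_incl (gadd_le h k) X \oc TP_mult q r X
  = TP_mult q' r' X \oc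
    (TP_incl h (TP_functor r' X) \oc fmap (TP_functor q) (TP_incl k X)).
Proof.
apply: (@eq_TP_hom (TP q (TP r X))) => -[[x A] QA].
rewrite /TP_pair /=; congr pair.
by rewrite !bigcup_in_image bigcup_image.
Qed.

Fact TP_mult_unitl (r : nnereal R) X :
  regrade TP_functor (gadd0l r) X
    \oc (TP_mult gzero r X \oc TP_unit (TP_functor r X))
  = idm (TP_functor r X).
Proof.
apply: (@eq_TP_hom (TP r X)) => -[[x A] QA].
rewrite [LHS]TP_pair_regrade /TP_pair /=; congr pair.
by rewrite bigcup_in_image bigcup_set1.
Qed.

Fact TP_mult_unitr (r : nnereal R) X :
  regrade TP_functor (gadd0r r) X
    \oc (TP_mult r gzero X \oc fmap (TP_functor r) (TP_unit X))
  = idm (TP_functor r X).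
Proof.
apply: (@eq_TP_hom (TP r X)) => -[[x A] QA].
rewrite [LHS]TP_pair_regrade /TP_pair /=; congr pair.
(* Each [y] in [A] has become the pair of [y] and its singleton, and [A] is the union of these
   singletons. *)
by rewrite bigcup_in_image bigcup_image bigcup_imset1 image_id.
Qed.

Fact TP_mult_assoc (p q r : nnereal R) X :
  regrade TP_functor (gaddA p q r) X
    \oc (TP_mult p (gadd q r) X \oc fmap (TP_functor p) (TP_mult q r X))
  = TP_mult (gadd p q) r X \oc TP_mult p q (TP_functor r X).
Proof.
apply: (@eq_TP_hom (TP p (TP q (TP r X)))) => -[[x A] QA].
rewrite [LHS]TP_pair_regrade /TP_pair /=; congr pair.
(* A union indexed by a union is a double union; the two sides are then compared for each [u] in
   [A]. *)
rewrite !bigcup_in_image bigcup_image bigcup_bigcup.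
by apply: eq_bigcupr => u _; apply: bigcup_in_image.
Qed.

Definition TP_monad : graded_monad TP_functor :=
  @GradedMonad (Met R) _ (nnereal R) TP_functor TP_incl TP_unit TP_mult
    TP_incl_refl TP_incl_trans TP_mult_incl TP_mult_unitl TP_mult_unitr TP_mult_assoc.

Lemma admissible_graded_monad : TP_graded_monad TP_pair.
Proof. by exists TP_functor_on; split=> //; exists TP_monad. Qed.

End PointedSubsets.

Section Variants.
Variable R : realType.
Local Open Scope ring_scope.
Local Open Scope ereal_scope.

Definition within_ball (r : nnereal R) (X : metspace R) (xA : X * set X) :=
  forall a, xA.2 a -> dist xA.1 a <= r%:num.

Definition meets_ball (r : nnereal R) (X : metspace R) (xA : X * set X) :=
  exists2 a, xA.2 a & dist xA.1 a <= r%:num.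

Lemma dist_le_gadd (X : metspace R) (x y z : X) (q r : nnereal R) :
  dist x y <= q%:num -> dist y z <= r%:num -> dist x z <= (gadd q r)%:num.
Proof. by move=> xy yz; apply: le_trans (leeD xy yz); apply: dist_triangle. Qed.

Lemma within_ball_admissible : admissible within_ball.
Proof.
split.
- by move=> r X Y f [x A] rA _ [a Aa <-]; apply: le_trans (nonexpP f _ _) (rA _ Aa).
- by move=> q r X [x A] qr qA a Aa; apply: le_trans (qA a Aa) qr.
- by move=> X x a ->; rewrite dist_refl.
- move=> q r X [[x A] qA] b; rewrite bigcup_in_image => -[y Ay yb].
  (* The triangle passes through the base point of [y], the element of [A] whose subset contains
     [b]. *)
  exact: (@dist_le_gadd X _ (sval y).1 _ q r (qA y Ay) (svalP y b yb)).
Qed.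

Lemma meets_ball_admissible : admissible meets_ball.
Proof.
split.
- move=> r X Y f [x A] [a Aa xa]; exists (f a); first by exists a.
  exact: le_trans (nonexpP f _ _) xa.
- by move=> q r X [x A] qr [a Aa xa]; exists a => //; apply: le_trans xa qr.
- by move=> X x; exists x; rewrite ?dist_refl.
(* Two successive witnesses: [y] in [A] near [x], then [b] in the subset of [y] near its base
   point. *)
- move=> q r X [[x A] [y Ay xy]]; have [b yb yb_le] := svalP y.
  exists b; last exact: (@dist_le_gadd X _ (sval y).1 _ q r xy yb_le).
  by rewrite bigcup_in_image; exists y.
Qed.

End Variants.

Theorem theorem7p6 (R : realType) :
  TP_graded_monad (@TPplus_pair R) /\ TP_graded_monad (@TPminus_pair R).
Proof.
split.
(* [TPplus] and [TPplus_pair] are convertible to [TP] and [TP_pair] at [within_ball]; likewise for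
   [TPminus] and [meets_ball]. *)
- exact: admissible_graded_monad (@within_ball_admissible R).
- exact: admissible_graded_monad (@meets_ball_admissible R).
Qed.
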